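(* Let $n=2m>3$ be an even integer and let $a,b$ be natural numbers with $1\le a<b\le n-1$. If one of $a,b$ is even and the other is odd, then $a$ and $b$ do not induce an $n$-polygon with $m$ axes, i.e. the $n$-tuple of sides $(a,b,a,b,\ldots,a,b)$ does not represent an $n$-polygon with $m$ axes.
   Context: Fix the vertices $v_k=e^{2\pi i k/n}$, $k=0,\ldots,n-1$, on the unit circle. An $n$-polygon is a Hamiltonian cycle through these vertices: a closed path $v_{\sigma_1}\cdots v_{\sigma_n}v_{\sigma_1}$ of straight segments with $(\sigma_1,\ldots,\sigma_n)$ an ordering of $0,\ldots,n-1$. Its sides are the integers $e_i\in\{1,\ldots,n-1\}$ with $e_i\equiv\sigma_{i+1}-\sigma_i\pmod n$; an $n$-tuple of sides represents a polygon if starting at a vertex and moving counterclockwise successively by the sides visits each vertex exactly once before returning to the start after the $n$-th step. An $n$-polygon with $m$ axes is one with exactly $m$ axes of reflection symmetry. *)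

(* Defs.v *)
(* MathComp and MathComp-Analysis; the plane is R[i], for R a realType. *)
From HB Require Import structures.
From mathcomp Require Export all_boot all_order all_algebra.
From mathcomp Require Export fingroup perm.
From mathcomp Require Export complex.
From mathcomp Require Export boolp classical_sets functions cardinality reals trigo.

Set Implicit Arguments.
Unset Strict Implicit.
Unset Printing Implicit Defensive.

Import Order.TTheory GRing.Theory Num.Theory.

Local Open Scope classical_set_scope.
Local Open Scope complex_scope.
Local Open Scope ring_scope.

Section Plane.
Variable R : realType.

Definition segment (z w : R[i]) : set R[i] :=
  [set (1 - t)%:C * z + t%:C * w | t in [set t : R | 0 <= t <= 1]].

Definition line (p d : R[i]) : set R[i] := [set p + t%:C * d | t in [set: R]].

(* For d != 0, conjugation in the frame with origin p and real axis along d,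
   i.e. the orthogonal reflection in [line p d]. *)
Definition reflection (p d z : R[i]) : R[i] := p + d / conjc d * conjc (z - p).

Definition reflection_axes (P : set R[i]) : set (set R[i]) :=
  [set L | exists p d : R[i],
     [/\ d != 0, L = line p d & reflection p d @` P = P]].

Definition has_axes (m : nat) (P : set R[i]) : Prop :=
  (reflection_axes P #= `I_m)%card.

Definition vertex (n k : nat) : R[i] :=
  cos (2 * pi * k%:R / n%:R) +i* sin (2 * pi * k%:R / n%:R).

(* The union of the straight segments of the closed path visiting the vertices
   in the order s 0, ..., s (n - 1), s 0; [ordS] is the cyclic successor. *)
Definition polygon (n : nat) (s : {perm 'I_n}) : set R[i] :=
  \bigcup_(i in [set: 'I_n])
    segment (vertex n (s i)) (vertex n (s (ordS i))).

End Plane.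

Arguments vertex R n k : clear implicits.
Arguments polygon R {n} s.

(* Index of the vertex reached from vertex k after the first j moves. *)
Definition walk (n : nat) (e : n.-tuple nat) (k j : nat) : nat :=
  ((k + \sum_(i < n | (i < j)%N) tnth e i) %% n)%N.

(* As s is a permutation, the first condition says that the walk visits each
   vertex exactly once during the steps 0, ..., n - 1, in the order s. *)
Definition represents (n : nat) (e : n.-tuple nat) (s : {perm 'I_n}) : Prop :=
  exists k : 'I_n,
    (forall j : 'I_n, walk e k j = s j :> nat) /\ walk e k n = k :> nat.

Definition represents_polygon_with_axes (R : realType) (n : nat)
    (e : n.-tuple nat) (m : nat) : Prop :=
  exists s : {perm 'I_n}, represents e s /\ has_axes m (polygon R s).

Definition alternating (n a b : nat) : n.-tuple nat :=
  [tuple (if odd i then b else a) | i < n].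

(* Main.v *)
Require Import Defs.

(** A closed walk has total displacement divisible by [n = 2m]; for the sides
    [(a, b, ..., a, b)] that displacement is [m (a + b)], so [a + b] is even
    and the mixed-parity walk does not even close up. *)

Lemma sum_alternating (m a b : nat) :
  (\sum_(i < 2 * m) (if odd i then b else a) = m * (a + b))%N.
Proof.
elim: m => [|m IHm]; first by rewrite muln0 big_ord0.
(* The last two indices, [2 * m] and [2 * m + 1], are even and odd, so they add [a] and [b]. *)
rewrite mulnS add2n !big_ord_recr /= IHm oddM /= mulSn.
by rewrite -addnA addnC.
Qed.

(** After [2 * m] moves every index passes the filter [i < j], so all sides are summed. *)
Lemma walk_alternating (m a b k : nat) :
  walk (alternating (2 * m) a b) k (2 * m) = ((k + m * (a + b)) %% (2 * m))%N.
Proof.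
rewrite /walk -sum_alternating; congr ((_ + _) %% _)%N.
by apply: eq_big => [i|i _]; rewrite ?ltn_ord ?tnth_mktuple.
Qed.

Theorem theorem3 (R : realType) (m n a b : nat) :
  n = (2 * m)%N -> (3 < n)%N ->
  (1 <= a)%N -> (a < b)%N -> (b <= n - 1)%N ->
  odd a != odd b ->
  ~ represents_polygon_with_axes R (alternating n a b) m.
Proof.
move=> -> n_gt3 _ _ _ odd_ab [s [[k [_ closed]] _]].
have m_gt0 : (0 < m)%N by case: m n_gt3 {s k closed}.
have : (2 * m %| m * (a + b))%N.
  (* As [k < 2 * m], [k] is its own residue; closure becomes a congruence in which [k] cancels. *)
  move: closed; rewrite walk_alternating -[RHS](modn_small (ltn_ord k)).
  by move/eqP; rewrite -{2}[nat_of_ord k]addn0 eqn_modDl mod0n.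
(* Cancelling [m > 0] leaves [2 %| a + b], which opposite parities forbid. *)
by rewrite mulnC dvdn_pmul2l // dvdn2 oddD negb_add (negbTE odd_ab).
Qed.
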